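(* The solvabilizer number of the alternating group $A_5$ is $3$, i.e. $\alpha(A_5)=3$.
   Context: For a finite group $G$, $R(G)$ denotes the solvable radical of $G$ (the largest solvable normal subgroup). For $x\in G$, the solvabilizer of $x$ is $\mathrm{Sol}_G(x)=\{y\in G\mid \langle x,y\rangle \text{ is solvable}\}$. For nonsolvable $G$, a solvabilizer covering of $G$ is a set $X\subset G\setminus R(G)$ such that $G=\bigcup_{x\in X}\mathrm{Sol}_G(x)$, and the solvabilizer number $\alpha(G)$ is the minimum cardinality of a solvabilizer covering of $G$. *)

(* Defs.v *)
From mathcomp Require Import all_boot all_fingroup all_solvable.

Set Implicit Arguments.
Unset Strict Implicit.
Unset Printing Implicit Defensive.

Local Open Scope group_scope.

Section Solvabilizers.

Variable gT : finGroupType.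
Implicit Types (x y : gT) (X : {set gT}) (G H K N : {group gT}).

(* As a join this is a group by construction; [sol_radical_sol],
   [sol_radical_normal] and [sol_radical_max] below show that it is the largest
   solvable normal subgroup. *)
Definition sol_radical G : {group gT} :=
  (\prod_(N : {group gT} | (N <| G) && solvable N) N)%G.

Definition solvabilizer G x : {set gT} :=
  [set y in G | solvable <<[set x; y]>>].

Definition solvabilizer_covering G X : bool :=
  (X \subset G :\: sol_radical G)
  && (G == \bigcup_(x in X) solvabilizer G x :> {set gT}).

(* [arg min] needs a candidate: for nonsolvable G, the set G :\: sol_radical G
   is a covering (see [solvabilizer_covering_setD]), so that the value is the
   true minimum ([solvabilizer_number_attained], [solvabilizer_number_min]).
   A solvable G has no covering, and its solvabilizer number is meaningless. *)
Definition solvabilizer_number G : nat :=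
  #|[arg min_(X < G :\: sol_radical G | solvabilizer_covering G X) #|X| ]|.

Lemma solvableY H K :
  H \subset 'N(K) -> solvable H -> solvable K -> solvable (H <*> K).
Proof.
move=> nKH solH solK; have nKHK: K <| H <*> K by rewrite normalYr.
by rewrite (series_sol nKHK) solK quotientYidr // quotient_sol.
Qed.

Lemma sol_radical_sol_normal G : (sol_radical G <| G) && solvable (sol_radical G).
Proof.
apply: (big_ind (fun N : {group gT} => (N <| G) && solvable N)) => //.
  by rewrite normal1 solvable1.
move=> H K /andP[nHG solH] /andP[nKG solK]; rewrite normalY //=.
by apply: solvableY => //; rewrite (subset_trans (normal_sub nHG)) ?normal_norm.
Qed.

Lemma sol_radical_normal G : sol_radical G <| G.
Proof. by case/andP: (sol_radical_sol_normal G). Qed.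

Lemma sol_radical_sol G : solvable (sol_radical G).
Proof. by case/andP: (sol_radical_sol_normal G). Qed.

Lemma sol_radical_max G N :
  N <| G -> solvable N -> N \subset sol_radical G.
Proof.
by move=> nNG solN; rewrite /sol_radical (bigD1 N) ?nNG //= joing_subl.
Qed.

Lemma solvabilizer_covering_setD G :
  ~~ solvable G -> solvabilizer_covering G (G :\: sol_radical G).
Proof.
move=> nsolG; rewrite /solvabilizer_covering subxx /= eqEsubset.
apply/andP; split; last by apply/bigcupsP => x _; apply/subsetP=> y; case/setIdP.
have /subsetPn[x xG xR]: ~~ (G \subset sol_radical G).
  by apply: contra nsolG => sGR; apply: solvableS (sol_radical_sol G).
have nRG := normal_norm (sol_radical_normal G).
apply/subsetP=> y yG; have [yR | yR] := boolP (y \in sol_radical G).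
  apply/bigcupP; exists x; rewrite ?inE ?xR // yG /=.
  have solxR: solvable (<[x]> <*> sol_radical G).
    apply: solvableY; rewrite ?sol_radical_sol ?abelian_sol ?cycle_abelian //.
    by rewrite cycle_subG (subsetP nRG).
  apply: solvableS solxR; rewrite gen_subG subUset !sub1set.
  by rewrite mem_gen ?inE ?cycle_id // mem_gen ?inE ?yR ?orbT.
apply/bigcupP; exists y; rewrite ?inE ?yR // yG setUid.
by rewrite abelian_sol // cycle_abelian.
Qed.

Lemma solvabilizer_number_attained G :
  ~~ solvable G ->
  exists2 X, solvabilizer_covering G X & #|X| = solvabilizer_number G.
Proof.
move=> nsolG; rewrite /solvabilizer_number.
case: arg_minnP => [|X covX _]; first exact: solvabilizer_covering_setD.
by exists X.
Qed.

Lemma solvabilizer_number_min G X :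
  solvabilizer_covering G X -> solvabilizer_number G <= #|X|.
Proof.
move=> covX; have [solG | nsolG] := boolP (solvable G).
  case/andP: covX => /subset_trans/(_ (setDS _ (sol_radical_max _ solG))).
  rewrite normal_refl setDv subset0 => /(_ isT)/eqP-> /eqP/setP/(_ 1).
  by rewrite big_set0 group1 inE.
rewrite /solvabilizer_number.
case: arg_minnP => [|Y _ minY]; first exact: solvabilizer_covering_setD.
exact: minY.
Qed.

End Solvabilizers.

(* Main.v *)
Require Import Defs.
From mathcomp Require Import all_boot all_fingroup all_solvable.

(* A solvable subgroup of a simple group G of order 60 that contains a Sylow
   5-subgroup P normalizes it: otherwise it has 6 Sylow 5-subgroups and index at
   most 2, hence is normal, so it is 1 or G, which is absurd. So an element x
   such that <x, y> is solvable for some generator y of P normalizes P. As a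
   nontrivial x normalizes at most 2 of the 6 Sylow 5-subgroups, a covering has
   at least 3 elements.

   Conversely, the 3 involutions of a Klein four-group V fixing a point e form a
   covering: an even permutation g either fixes e, and then normalizes V, or is
   an involution, or is a 3- or 5-cycle inverted by an involution fixing e. The
   subgroup <v, g> is then contained in <g>V or dihedral. *)

Set Implicit Arguments.
Unset Strict Implicit.
Unset Printing Implicit Defensive.

Local Open Scope group_scope.

(** * Sylow 5-subgroups of a simple group of order 60, and the lower bound *)

Section SimpleOrder60.

Variables (gT : finGroupType) (G : {group gT}).
Hypotheses (simpleG : simple G) (oG : #|G| = 60).
Implicit Types (x y p : gT) (H P Q R : {group gT}) (X : {set gT}).

Lemma simple60_nonsolvable : ~~ solvable G.
Proof. by apply/negP=> /simple_sol_prime/(_ simpleG); rewrite oG. Qed.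

Lemma simple60_solvable_normal1 H : H <| G -> solvable H -> H :=: 1.
Proof.
case/simpleP: simpleG => _ simG /simG[] // -> solG.
by have := simple60_nonsolvable; rewrite solG.
Qed.

Lemma card_Syl5 P : 5.-Sylow(G) P -> #|P| = 5.
Proof. by move/card_Hall->; rewrite oG p_part. Qed.

(** The index counts the Sylow 5-subgroups of [H], so it is 1 modulo 5; it also divides 60 / 5 =
    12. *)
Lemma Syl5_index_norm H P :
    H \subset G -> 5.-Sylow(G) P -> P \subset H ->
  P <| H \/ #|H : 'N_H(P)| = 6.
Proof.
move=> sHG sylP sPH; have sylPH := pHall_subl sPH sHG sylP.
have n_mod5 := card_Syl_mod H (isT : prime 5).
have n_dvd12 : #|H : 'N_H(P)| %| 12.
  rewrite -(dvdn_pmul2r (isT : 0 < 5)) -[(12 * 5)%N]/60 -oG.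
  rewrite -[5](card_Syl5 sylP).
  apply: dvdn_trans (cardSg sHG).
  rewrite -(Lagrange (subsetIl H 'N(P))) mulnC dvdn_pmul2r ?indexg_gt0 //.
  by rewrite cardSg // subsetI sPH normG.
rewrite (card_Syl sylPH) in n_mod5.
have: #|H : 'N_H(P)| \in divisors 12 by rewrite -dvdn_divisors.
rewrite !inE => /or4P[/eqP n1|/eqP n2|/eqP n3|].
- left; rewrite /normal sPH; apply/setIidPl/eqP; rewrite eqEcard subsetIl.
  by rewrite -(Lagrange (subsetIl H 'N(P))) n1 muln1 leqnn.
- by rewrite n2 in n_mod5.
- by rewrite n3 in n_mod5.
by case/or3P=> /eqP n456; rewrite n456 in n_mod5 *; [|right|].
Qed.

Lemma solvable_Syl5_normal H P :
    H \subset G -> solvable H -> 5.-Sylow(G) P -> P \subset H -> P <| H.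
Proof.
move=> sHG solH sylP sPH; have [//|iHN] := Syl5_index_norm sHG sylP sPH.
suff nHG : H <| G.
  by have:= cardSg sPH; rewrite (card_Syl5 sylP)
    (simple60_solvable_normal1 nHG solH) cards1.
have sPN : P \subset 'N_H(P) by rewrite subsetI sPH normG.
(* The order of [H] is a multiple of 5 * 6 = 30, since ['N_H(P)] contains [P] and has index 6. *)
have : #|G : H| \in divisors 2.
  rewrite -dvdn_divisors // -(dvdn_pmul2l (isT : 0 < 30)).
  rewrite -[(30 * 2)%N]/60 -oG -(Lagrange sHG).
  rewrite dvdn_pmul2r ?indexg_gt0 // -(Lagrange (subsetIl H 'N(P))) iHN.
  by rewrite -[30]/(5 * 6)%N dvdn_pmul2r // -[5](card_Syl5 sylP) cardSg.
rewrite !inE => /orP[] /eqP iGH; last exact: index2_normal.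
suff -> : H :=: G by apply: normal_refl.
by apply/eqP; rewrite eqEcard sHG -(Lagrange sHG) iGH muln1 leqnn.
Qed.

Lemma Syl5_not_normal P : 5.-Sylow(G) P -> ~~ (P <| G).
Proof.
move=> sylP; apply/negP=> nPG; have oP := card_Syl5 sylP.
have solP : solvable P by apply: nilpotent_sol (pgroup_nil (pHall_pgroup sylP)).
by move: oP; rewrite (simple60_solvable_normal1 nPG solP) cards1.
Qed.

Lemma card_Syl5_set : #|'Syl_5(G)| = 6.
Proof.
have [P sylP] := Sylow_exists 5 G; rewrite (card_Syl sylP).
have [nPG|//] := Syl5_index_norm (subxx G) sylP (pHall_sub sylP).
by case/negP: (Syl5_not_normal sylP).
Qed.

(** As [P] has prime order, [p] generates it, so [P] normalizes [Q]; a 5-subgroup of [G] normalizing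
    a Sylow 5-subgroup lies in it. *)
Lemma Syl5_norm_TI P Q p :
    5.-Sylow(G) P -> 5.-Sylow(G) Q -> p \in P -> p != 1 -> p \in 'N(Q) ->
  P = Q.
Proof.
move=> sylP sylQ Pp p_neq1 nQp.
have oP := card_Syl5 sylP; have oQ := card_Syl5 sylQ.
have defP : P :=: <[p]> by apply: nt_gen_prime; rewrite ?oP // !inE p_neq1.
have nQP : P \subset 'N(Q) by rewrite defP cycle_subG.
have maxQ := Hall_max sylQ.
apply/val_inj/eqP; rewrite eqEcard oP oQ leqnn andbT.
exact: norm_sub_max_pgroup maxQ (pHall_pgroup sylP) (pHall_sub sylP) nQP.
Qed.

(** By [Syl5_norm_TI] the stabilizer of [Q] in [P] is trivial, so the orbit of [Q] has 5 elements,
    which are all the Sylow 5-subgroups but [P]. *)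
Lemma Syl5_trans P Q R :
    5.-Sylow(G) P -> 5.-Sylow(G) Q -> 5.-Sylow(G) R -> Q != P -> R != P ->
  exists2 p, p \in P & R = (Q :^ p)%G.
Proof.
move=> sylP sylQ sylR neqQP neqRP.
suff /setP/(_ R) : orbit 'JG P Q = 'Syl_5(G) :\ P.
  by rewrite !inE neqRP sylR => /orbitP[p Pp <-]; exists p.
apply/eqP; rewrite eqEcard; apply/andP; split.
  apply/subsetP=> _ /orbitP[p Pp <-] /=; rewrite !inE.
  rewrite pHallJ ?sylQ ?(subsetP (pHall_sub sylP)) // andbT.
  apply: contraNneq neqQP => eqQP; apply/eqP/val_inj/(@conjsg_inj _ p).
  by rewrite (conjGid Pp); apply: (congr_group eqQP).
rewrite card_orbit astab1JG (_ : 'N_P(Q) = 1); last first.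
  apply/trivgP/subsetP=> p /setIP[Pp nQp]; rewrite inE.
  by apply: contraNT neqQP => p_neq1; rewrite (Syl5_norm_TI sylP sylQ Pp).
rewrite indexg1 (card_Syl5 sylP).
have:= cardsD1 P 'Syl_5(G); rewrite inE sylP card_Syl5_set => -[].
by rewrite add0n => <-.
Qed.

Definition Syl5_fix x : {set {group gT}} := [set P in 'Syl_5(G) | x \in 'N(P)].

Lemma in_Syl5_fix x P : (P \in Syl5_fix x) = 5.-Sylow(G) P && (x \in 'N(P)).
Proof. by rewrite !inE. Qed.

(* [G] is faithful on its Sylow 5-subgroups because the pointwise stabilizer is
   normal and none of them is. *)
Lemma Syl5_fix_all x :
  x \in G -> (forall P, 5.-Sylow(G) P -> x \in 'N(P)) -> x = 1.
Proof.
move=> Gx nx; have [P sylP] := Sylow_exists 5 G.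
have xK : x \in gcore 'N_G(P) G.
  apply/bigcapP=> g Gg; rewrite conjIg conjGid // -normJ inE Gx.
  by apply: (nx (P :^ g)%G); rewrite pHallJ.
have sNG := subsetIl G 'N(P); have nKG := gcore_normal sNG.
case/simpleP: simpleG => _ /(_ _ nKG)[] defK.
  by apply/set1P; rewrite -[[set 1]]defK.
case/negP: (Syl5_not_normal sylP); rewrite /normal (pHall_sub sylP).
by apply: subset_trans (subsetIr G _); rewrite -{1}defK gcore_sub.
Qed.

(* If [x] normalizes [P], [Q] and [Q :^ p] with [p] in [P], then [[x, p]] lies
   in [P] and normalizes [Q :^ p], so that [x] centralizes [P], hence fixes
   every conjugate of [Q] under [P]. *)
Lemma card_Syl5_fix x : x \in G -> x != 1 -> #|Syl5_fix x| <= 2.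
Proof.
move=> Gx; apply: contraNleq => /card_gt2P[P [Q [R [[]]]]].
rewrite !in_Syl5_fix => /andP[sylP nPx] /andP[sylQ nQx] /andP[sylR nRx].
rewrite (eq_sym P) => -[neqQP neqQR neqRP].
have [p Pp defR] := Syl5_trans sylP sylQ sylR neqQP neqRP.
have oP := card_Syl5 sylP.
have p_neq1 : p != 1.
  apply: contraNneq neqQR => p1; apply/eqP/val_inj.
  by rewrite defR /= p1 conjsg1.
have defP : P :=: <[p]> by apply: nt_gen_prime; rewrite ?oP // !inE p_neq1.
have cpx : [~ p, x] = 1.
  apply: contraNeq neqRP => c_neq1.
  rewrite (Syl5_norm_TI sylP sylR _ c_neq1) //.
    by rewrite commgEl groupM ?groupV // memJ_norm.
  by rewrite commgEr groupM // defR /= normJ memJ_conjg groupV.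
have cPx : x \in 'C(P).
  by rewrite defP cent_cycle; apply/cent1P/esym/commgP/eqP.
apply/eqP/Syl5_fix_all=> // S sylS; have [-> //|neqSP] := eqVneq S P.
have [q Pq ->] := Syl5_trans sylP sylQ sylS neqQP neqSP.
rewrite /= normJ mem_conjg conjgE invgK mulgA.
by rewrite -(centP cPx q Pq) mulgK.
Qed.

Lemma covering60_card X : solvabilizer_covering G X -> 2 < #|X|.
Proof.
case/andP=> sXGR /eqP covX.
have sSylX : 'Syl_5(G) \subset \bigcup_(x in X) Syl5_fix x.
  apply/subsetP=> P; rewrite inE => sylP; have oP := card_Syl5 sylP.
  have [y Py y_neq1] : exists2 y, y \in P & y != 1.
    by apply/trivgPn; rewrite trivg_card1 oP.
  have defP : P :=: <[y]> by apply: nt_gen_prime; rewrite ?oP // !inE y_neq1.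
  have := subsetP (pHall_sub sylP) y Py; rewrite {1}covX.
  case/bigcupP=> x Xx; rewrite inE => /andP[Gy solxy].
  apply/bigcupP; exists x => //; rewrite in_Syl5_fix sylP.
  have Gx : x \in G by have := subsetP sXGR x Xx; rewrite inE => /andP[].
  have sHG : <<[set x; y]>> \subset G.
    by rewrite gen_subG subUset !sub1set Gx Gy.
  have sPH : P \subset <<[set x; y]>>.
    by rewrite defP cycle_subG mem_gen // !inE eqxx orbT.
  have /normal_norm/subsetP -> // := solvable_Syl5_normal sHG solxy sylP sPH.
  by rewrite mem_gen // !inE eqxx.
(* The sets [Syl5_fix x], of at most 2 elements each, cover 6 subgroups: 2 * 2 < 6 <= 2 * [#|X|]. *)
rewrite -(ltn_pmul2r (isT : 0 < 2)); apply: leq_trans (isT : 4 < 6) _.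
rewrite -card_Syl5_set -sum_nat_const (leq_trans (subset_leq_card sSylX)) //.
apply: (big_ind2 (fun (S : {set {group gT}}) n => #|S| <= n)).
- by rewrite cards0.
- by move=> S m T n Sm Tn; exact: leq_trans (leq_card_setU S T) (leq_add Sm Tn).
move=> x Xx; have := subsetP sXGR x Xx.
rewrite inE => /andP[xR Gx]; apply: card_Syl5_fix => //.
by apply: contraNneq xR => ->; apply: group1.
Qed.

End SimpleOrder60.

(** * Computing with permutations of five points *)

(* A permutation is encoded by the list of its values, in order to check facts
   about the 120 elements of ['S_5] by computation. *)
Definition code (g : 'S_5) : seq nat := [seq nat_of_ord (g i) | i <- enum 'I_5].

(** The left factor acts first, as in products of permutations. *)
Definition code_comp (s t : seq nat) : seq nat := [seq nth 0 t i | i <- s].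

Definition transp (i j k : nat) : nat :=
  if k == i then j else if k == j then i else k.

Definition code_tperm (i j : nat) : seq nat := [seq transp i j k | k <- iota 0 5].

(** The permutations (0 1)(2 3), (0 2)(1 3) and (0 3)(1 2). *)
Definition code_V4D1 : seq (seq nat) :=
  [:: [:: 1; 0; 3; 2; 4]; [:: 2; 3; 0; 1; 4]; [:: 3; 2; 1; 0; 4]]%N.

(* Multiplying [g] by the transposition of [n] and [g n] makes it fix [n];
   counting the nontrivial ones for [n = 4, 3, 2, 1, 0] gives the parity. *)
Fixpoint code_odd (n : nat) (s : seq nat) : bool :=
  if n is m.+1 then
    (nth 0 s m != m) (+) code_odd m (code_comp s (code_tperm (nth 0 s m) m))
  else false.

(** What the multiplications in [code_odd] leave of [s]; the parity is right once this is the
    identity. *)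
Fixpoint code_reduce (n : nat) (s : seq nat) : seq nat :=
  if n is m.+1 then code_reduce m (code_comp s (code_tperm (nth 0 s m) m))
  else s.

Lemma nth_code g (i : 'I_5) : nth 0 (code g) i = g i.
Proof. by rewrite (nth_map i) ?size_enum_ord // nth_ord_enum. Qed.

Lemma code_inj : injective code.
Proof.
by move=> g h eq_gh; apply/permP=> i; apply/ord_inj; rewrite -!nth_code eq_gh.
Qed.

Lemma codeM g h : code (g * h) = code_comp (code g) (code h).
Proof.
by rewrite /code_comp -map_comp; apply: eq_map => i /=; rewrite permM nth_code.
Qed.

Lemma code1 : code 1 = iota 0 5.
Proof. by rewrite -val_enum_ord; apply: eq_map => i; rewrite perm1. Qed.

Lemma codeT (i j : 'I_5) : code (tperm i j) = code_tperm i j.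
Proof.
rewrite /code_tperm -val_enum_ord -map_comp; apply: eq_map => k /=.
rewrite /transp !(inj_eq (@ord_inj 5)).
case: tpermP => [->|->|/eqP/negPf-> /eqP/negPf->]; rewrite ?eqxx //.
by case: eqP => // ->.
Qed.

Lemma code_permutations g : code g \in permutations (iota 0 5).
Proof.
rewrite mem_permutations; apply: uniq_perm; rewrite ?iota_uniq //.
  by rewrite map_inj_uniq ?enum_uniq // => i j /val_inj/perm_inj.
move=> k; rewrite mem_iota /= add0n; apply/mapP/idP => [[i _ ->] //|lt_k5].
by exists (g^-1 (Ordinal lt_k5)); rewrite ?mem_enum ?permKV.
Qed.

Lemma odd_perm_code n g :
    n <= 5 -> code_reduce n (code g) = iota 0 5 ->
  odd_perm g = code_odd n (code g).
Proof.
elim: n g => [|n IHn] g /= lt_n5.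
  by move=> red_g; rewrite (code_inj (etrans red_g (esym code1))) odd_perm1.
pose k := Ordinal lt_n5; rewrite (nth_code g k) -(codeT _ k) -codeM => red_g.
rewrite -IHn ?(ltnW lt_n5) // odd_permM odd_tperm.
by rewrite -(inj_eq (@ord_inj 5)) addbCA addbb addbF.
Qed.

Lemma code_reduce_id g : code_reduce 5 (code g) = iota 0 5.
Proof.
apply/eqP; move: (code g) (code_permutations g).
by apply/allP; vm_compute.
Qed.

(** For even [s], the alternatives are: some [v] inverts [s], as [s v] has square 1; [s] has square
    1; [s] normalizes the four-group, where [v s = s w] expresses conjugation without inverses. *)
Lemma V4_code_cover (s : seq nat) : s \in permutations (iota 0 5) ->
  [|| code_odd 5 s,
      has (fun v => code_comp (code_comp s v) (code_comp s v) == iota 0 5)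
          code_V4D1,
      code_comp s s == iota 0 5
    | all (fun v => code_comp v s \in [seq code_comp s w | w <- code_V4D1])
          code_V4D1].
Proof. by move: s; apply/allP; vm_compute. Qed.

(** * The covering by three involutions, and the upper bound *)

(** The dihedral case: [a] inverts [a * b], hence normalizes the cyclic group [<[a * b]>]. *)
Lemma solvable_involutions (gT : finGroupType) (a b : gT) :
  a * a = 1 -> b * b = 1 -> solvable <<[set a; b]>>.
Proof.
move=> aa bb; have solc (c : gT) : solvable <[c]>.
  by rewrite abelian_sol ?cycle_abelian.
have nab : a \in 'N(<[a * b]>).
  rewrite inE -cycleJ cycle_subG -groupV.
  have -> : ((a * b) ^ a)^-1 = a * b; last exact: cycle_id.
  have [aV bV] : a^-1 = a /\ b^-1 = b.
    by split; apply/eqP; rewrite eq_invg_mul ?aa ?bb.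
  by rewrite conjgE -mulgA mulKg invMg aV bV.
have sol_ab : solvable (<[a]> <*> <[a * b]>).
  by apply: solvableY (solc a) (solc _); rewrite cycle_subG.
apply: solvableS sol_ab; rewrite gen_subG subUset !sub1set.
have ain : a \in <[a]> <*> <[a * b]> by rewrite mem_gen // inE cycle_id.
by rewrite ain -(groupMl _ ain) mem_gen // inE cycle_id orbT.
Qed.

(* Only the three involutions of the four-group that fixes the point 4. *)
Definition V4D1 : {set 'S_5} := [set g | code g \in code_V4D1].

Definition tperm5 i j : 'S_5 := tperm (inord i) (inord j).

(** Shows that each of the three codes comes from a permutation. *)
Definition V4D1_elts : seq 'S_5 :=
  [:: tperm5 0 1 * tperm5 2 3; tperm5 0 2 * tperm5 1 3; tperm5 0 3 * tperm5 1 2].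

Lemma code_V4D1_elts : map code V4D1_elts = code_V4D1.
Proof. by rewrite /= !codeM !codeT !inordK. Qed.

Lemma mem_V4D1 g : (g \in V4D1) = (g \in V4D1_elts).
Proof. by rewrite inE -code_V4D1_elts mem_map //; apply: code_inj. Qed.

Lemma card_V4D1 : #|V4D1| = 3.
Proof.
rewrite (eq_card mem_V4D1) (card_uniqP _) // -(map_inj_uniq code_inj).
by rewrite code_V4D1_elts.
Qed.

Lemma V4D1_gen_abelian : abelian <<V4D1>>.
Proof.
rewrite abelian_gen; apply/centsP=> x; rewrite inE => xV y; rewrite inE => yV.
apply: code_inj; rewrite !codeM; apply/eqP.
have /allP/(_ _ xV)/allP/(_ _ yV) // :
  all (fun s => all (fun t => code_comp s t == code_comp t s) code_V4D1) code_V4D1.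
by [].
Qed.

Lemma V4D1_involution v : v \in V4D1 -> v * v = 1.
Proof.
rewrite inE => vV; apply: code_inj; rewrite codeM code1; apply/eqP.
by move: (code v) vV; apply/allP.
Qed.

Lemma simple_Alt5_ord : simple 'Alt_('I_5).
Proof. by apply: simple_Alt5; rewrite card_ord. Qed.

Lemma card_Alt5_ord : #|'Alt_('I_5)| = 60.
Proof. by apply: double_inj; rewrite -mul2n card_Alt card_ord. Qed.

Lemma V4D1_sub : V4D1 \subset 'Alt_('I_5) :\: sol_radical 'Alt_('I_5)%G.
Proof.
have radA1 : sol_radical 'Alt_('I_5)%G :=: 1.
  apply: simple60_solvable_normal1 simple_Alt5_ord card_Alt5_ord _ _ _.
    exact: sol_radical_normal.
  exact: sol_radical_sol.
apply/subsetP=> v; rewrite inE => vV; rewrite in_setD radA1; apply/andP; split.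
  by apply: contraTN vV => /set1P->; rewrite code1.
rewrite Alt_even (odd_perm_code (leqnn 5) (code_reduce_id v)).
by move: (code v) vV; apply/allP.
Qed.

Lemma V4D1_covering : solvabilizer_covering 'Alt_('I_5)%G V4D1.
Proof.
rewrite /solvabilizer_covering V4D1_sub eqEsubset /=; apply/andP; split; last first.
  by apply/bigcupsP=> x _; apply/subsetP=> y; case/setIdP.
apply/subsetP=> g Ag.
have [v0 v0V] : exists v, v \in V4D1 by apply/card_gt0P; rewrite card_V4D1.
suff [v vV sol_vg] : exists2 v, v \in V4D1 & solvable <<[set v; g]>>.
  by apply/bigcupP; exists v; rewrite // inE Ag.
have := V4_code_cover (code_permutations g).
rewrite -(odd_perm_code (leqnn 5) (code_reduce_id g)).
have /negPf-> : ~~ odd_perm g by rewrite -Alt_even.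
rewrite orFb -code_V4D1_elts.
case/or3P=> [/hasP[_ /mapP[v vV ->]]|/eqP g2|/allP nVg].
- rewrite -!codeM -code1 => /eqP/code_inj gv2.
  have {}vV : v \in V4D1 by rewrite mem_V4D1.
  exists v => //.
  (* [v] and [g * v], both of square 1, generate the same group as [v] and [g]. *)
  apply: solvableS (solvable_involutions (V4D1_involution vV) gv2).
  rewrite gen_subG subUset !sub1set.
  have v_in : v \in <<[set v; g * v]>> by rewrite mem_gen // !inE eqxx.
  by rewrite v_in -(groupMr _ v_in) mem_gen // !inE eqxx orbT.
- exists v0 => //; apply: solvable_involutions (V4D1_involution v0V) _.
  by apply: code_inj; rewrite codeM code1.
exists v0 => //.
(* Here [v * g = g * w] says that [v ^ g = w] lies in [V4D1] again. *)
have nVg' : g \in 'N(<<V4D1>>).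
  rewrite (subsetP (norm_gen _)) // inE; apply/subsetP=> _ /imsetP[v vV ->].
  have vV' := vV; rewrite mem_V4D1 in vV'.
  have := nVg _ (map_f code vV'); rewrite -map_comp => /mapP[w wV].
  by rewrite /= -!codeM => /code_inj vg; rewrite conjgE vg mulKg mem_V4D1.
have sol_gV : solvable (<[g]> <*> <<V4D1>>).
  apply: solvableY; rewrite ?cycle_subG ?abelian_sol ?cycle_abelian //.
  exact: V4D1_gen_abelian.
apply: solvableS sol_gV; rewrite gen_subG subUset !sub1set.
by rewrite !mem_gen // inE ?cycle_id // (mem_gen v0V) orbT.
Qed.

Theorem theorem2p10 : solvabilizer_number 'Alt_('I_5)%G = 3.
Proof.
apply/eqP; rewrite eqn_leq; apply/andP; split.
  by have := solvabilizer_number_min V4D1_covering; rewrite card_V4D1.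
have [X covX <-] := solvabilizer_number_attained
  (simple60_nonsolvable simple_Alt5_ord card_Alt5_ord).
exact: covering60_card simple_Alt5_ord card_Alt5_ord _ covX.
Qed.
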